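(* Let $(X,\mathcal A)$ be a measurable space such that $\dim\mathcal M(X)=\infty$ and let $H$ be the reproducing kernel Hilbert space of a characteristic kernel $k$ on $X$. Then for all $P\in\mathcal M_1(X)$, $\delta\in(0,2]$ and $\varepsilon\in(0,\delta)$ there exist $Q_1,Q_2\in\mathcal M_1(X)$ such that $\|P-Q_i\|_{\mathrm{TV}}\le\delta$ for $i=1,2$, $\|Q_1-Q_2\|_{\mathrm{TV}}=\delta$, and $\|Q_1-Q_2\|_H\le\varepsilon$.
   Context: A kernel on $X$ is a symmetric positive definite function $k:X\times X\to\mathbb R$ (i.e. $\sum_{i,j}a_ia_jk(x_i,x_j)\ge0$ for all finite choices). $\mathcal M(X)$ is the space of finite signed measures on $(X,\mathcal A)$, $\mathcal M_1(X)\subset\mathcal M(X)$ the set of probability measures, and $\|\mu\|_{\mathrm{TV}}=|\mu|(X)$ the total variation norm. For a bounded measurable kernel $k$ with RKHS $H$, the kernel embedding is $\Phi:\mathcal M(X)\to H$, $\Phi(\mu):=\int_X k(\cdot,x)\,\mathrm d\mu(x)$ (Pettis integral), and $\|\mu\|_H:=\|\Phi(\mu)\|_H$. A bounded measurable kernel $k$ is called characteristic if the restriction of $\Phi$ to $\mathcal M_1(X)$ is injective. *)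

(* Defs.v *)
From HB Require Import structures.
From mathcomp Require Import all_boot all_order all_algebra.
From mathcomp Require Import all_classical all_reals all_analysis.

Set Implicit Arguments.
Unset Strict Implicit.
Unset Printing Implicit Defensive.

Import Order.TTheory GRing.Theory Num.Theory.
Import numFieldNormedType.Exports.

Local Open Scope classical_set_scope.
Local Open Scope ring_scope.

Section signed_measures.
Context (d : measure_display) (X : measurableType d) (R : realType).
Implicit Types (mu nu : {charge set X -> \bar R}) (P Q : probability X R).

(* A charge also assigns values to non-measurable sets; those values are
   irrelevant, so signed measures are compared on measurable sets only. *)
Definition meas_eq (m1 m2 : set X -> \bar R) : Prop :=
  forall A, measurable A -> m1 A = m2 A.

Definition finite_dim_signed_measures : Prop :=
  exists n (mu : 'I_n -> {charge set X -> \bar R}),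
    forall nu, exists a : 'I_n -> R,
      meas_eq nu (fun A => (\sum_(i < n) (a i)%:E * mu i A)%E).

Definition prob_charge P : {charge set X -> \bar R} :=
  charge_of_finite_measure P.

Definition charge_sub mu nu : {charge set X -> \bar R} := cadd mu (copp nu).

(* A Hahn decomposition is unique only up to null sets, but the Jordan
   decomposition and the variation do not depend on the one chosen here. *)
Definition hahn_pos mu : set X := projT1 (cid (Hahn_decomposition mu)).

Definition hahn_neg mu : set X :=
  projT1 (cid (projT2 (cid (Hahn_decomposition mu)))).

Definition hahnP mu : hahn_decomposition mu (hahn_pos mu) (hahn_neg mu) :=
  projT2 (cid (projT2 (cid (Hahn_decomposition mu)))).

Definition tv_norm mu : \bar R := charge_variation (hahnP mu) setT.

Definition charge_integrable mu (f : X -> R) : Prop :=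
  (charge_variation (hahnP mu)).-integrable setT (EFin \o f).

Definition charge_integral mu (f : X -> R) : R :=
  Rintegral (jordan_pos (hahnP mu)) setT f
  - Rintegral (jordan_neg (hahnP mu)) setT f.

Definition is_pettis_integral (V : normedModType R) mu (F : X -> V) (v : V) :=
  forall phi : {linear V -> R^o}, continuous phi ->
    charge_integrable mu (phi \o F) /\ phi v = charge_integral mu (phi \o F).

(* 0 is a default value, taken only when F is not Pettis integrable. *)
Definition pettis_integral (V : normedModType R) mu (F : X -> V) : V :=
  xget 0 [set v | is_pettis_integral mu F v].

End signed_measures.

Definition is_kernel (X : Type) (R : realType) (k : X -> X -> R) : Prop :=
  (forall x y, k x y = k y x) /\
  (forall n (a : 'I_n -> R) (x : 'I_n -> X),
     0 <= \sum_(i < n) \sum_(j < n) a i * a j * k (x i) (x j)).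

(* A reproducing kernel Hilbert space of k, as a Hilbert space whose elements
   are identified with functions on X through the injection rkhs_fun. *)
Record rkhs (X : Type) (R : realType) (k : X -> X -> R) := RKHS {
  rkhs_sort :> completeNormedModType R ;
  rkhs_dot : {dot rkhs_sort for idfun} ;
  rkhs_normE : forall f : rkhs_sort, `|f| ^+ 2 = rkhs_dot f f ;
  rkhs_fun : {linear rkhs_sort -> (X -> R^o)} ;
  rkhs_fun_inj : injective rkhs_fun ;
  (* rkhs_feature x is the element k(., x) *)
  rkhs_feature : X -> rkhs_sort ;
  rkhs_featureE : forall x y, rkhs_fun (rkhs_feature x) y = k y x ;
  rkhs_reproducing :
    forall (f : rkhs_sort) x, rkhs_fun f x = rkhs_dot f (rkhs_feature x) }.

Section kernel_embedding.
Context (d : measure_display) (X : measurableType d) (R : realType).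
Context (k : X -> X -> R) (H : rkhs k).

Definition kernel_embedding (mu : {charge set X -> \bar R}) : H :=
  pettis_integral mu (@rkhs_feature _ _ _ H).

Definition rkhs_norm (mu : {charge set X -> \bar R}) : R :=
  `|kernel_embedding mu|.

Definition bounded_measurable_kernel : Prop :=
  [/\ is_kernel k,
      measurable_fun [set: X * X] (fun z => k z.1 z.2) &
      exists M : R, forall x y, `|k x y| <= M].

Definition characteristic : Prop :=
  bounded_measurable_kernel /\
  forall P Q : probability X R,
    kernel_embedding (prob_charge P) = kernel_embedding (prob_charge Q) ->
    meas_eq P Q.

End kernel_embedding.

(* Main.v *)
(* Write Q_i = (1 - delta/2) P + (delta/2) nu_i, with nu_1, nu_2 mutually singular
   averages of N Dirac masses. Then Q_1 - Q_2 has total variation delta, each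
   P - Q_i = (delta/2) (P - nu_i) has total variation at most delta, and only
   |nu_1 - nu_2|_H has to be made small. Infinite dimension of the signed measures
   provides 2N points pairwise separated by measurable sets. Group them in pairs
   and let w_j be the difference of the two features in the pair j: suitable signs
   satisfy |sum_j +-w_j|^2 <= sum_j |w_j|^2 <= 4 M N, where M bounds the kernel.
   The sign chosen for j decides which point of the pair goes to nu_1 and which
   one to nu_2, so that |nu_1 - nu_2|_H^2 <= 4 M / N. *)

From HB Require Import structures.
Require Import Defs.
From mathcomp Require Import all_boot all_order all_algebra.
From mathcomp Require Import all_classical all_reals all_analysis.
From mathcomp Require Import measurable_realfun zify ring lra.

Set Implicit Arguments.
Unset Strict Implicit.

Import Order.TTheory GRing.Theory Num.Theory.
Import numFieldNormedType.Exports.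

Local Open Scope classical_set_scope.
Local Open Scope ring_scope.

(** * Inner product geometry of the RKHS *)

Section rkhs_geometry.
Context (X : Type) (R : realType) (k : X -> X -> R) (H : rkhs k).
Implicit Types u v : H.

Lemma rkhs_dotC u v : rkhs_dot H u v = rkhs_dot H v u.
Proof. by rewrite hermC expr0 mul1r. Qed.

Lemma rkhs_normD u v :
  `|u + v| ^+ 2 = `|u| ^+ 2 + rkhs_dot H u v *+ 2 + `|v| ^+ 2.
Proof.
by rewrite !rkhs_normE linearDl /= !linearDr /= (rkhs_dotC v u) mulr2n !addrA.
Qed.

Lemma rkhs_normB u v :
  `|u - v| ^+ 2 = `|u| ^+ 2 - rkhs_dot H u v *+ 2 + `|v| ^+ 2.
Proof. by rewrite rkhs_normD normrN linearNr mulNrn. Qed.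

(** By polarization the inner product is a combination of squared norms, which are continuous. *)
Lemma rkhs_dot_continuous v : continuous (rkhs_dot H v).
Proof.
have -> : rkhs_dot H v = (fun u => (`|v + u| ^+ 2 - `|v - u| ^+ 2) / 4) :> (H -> R).
  by apply/funext => u; rewrite rkhs_normD rkhs_normB; lra.
move=> u; apply: cvgM; last exact: cvg_cst.
apply: cvgB; rewrite expr2; under eq_fun do rewrite expr2.
  by apply: cvgM; apply: cvg_norm; apply: cvgD => //; apply: cvg_cst.
by apply: cvgM; apply: cvg_norm; apply: cvgB => //; apply: cvg_cst.
Qed.

Lemma rkhs_feature_normB (M : R) : (forall x y, `|k x y| <= M) ->
  forall x y, `|rkhs_feature H x - rkhs_feature H y| ^+ 2 <= 4 * M.
Proof.
move=> kM x y; rewrite rkhs_normB !rkhs_normE -!rkhs_reproducing !rkhs_featureE.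
by have := kM x x; have := kM y y; have := kM y x; rewrite !ler_norml; lra.
Qed.

(* Choose the signs one at a time, each making the new cross term nonpositive. *)
Lemma rkhs_sign_balancing n (w : nat -> H) : exists s : nat -> bool,
  `|\sum_(j < n) (-1) ^+ s j *: w j| ^+ 2 <= \sum_(j < n) `|w j| ^+ 2.
Proof.
elim: n => [|n [s IH]].
  by exists (fun=> false); rewrite !big_ord0 normr0 expr0n.
pose u := \sum_(j < n) (-1) ^+ s j *: w j.
exists (fun j => if j == n then 0 < rkhs_dot H u (w n) else s j).
rewrite !big_ord_recr /= eqxx (eq_bigr (fun j : 'I_n => (-1) ^+ s j *: w j)).
  rewrite -/u rkhs_normD normrZ normr_sign mul1r lerD2r.
  apply: le_trans IH; rewrite gerDl -mulr_natr pmulr_lle0 //.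
  case: ltP => h; first by rewrite expr1 scaleN1r linearNr oppr_le0 ltW.
  by rewrite expr0 scale1r.
by move=> j _; rewrite ltn_eqF.
Qed.

(** The codomain is typed [R^o] so that the inner product can serve as a linear test functional in
    [is_pettis_integral]. *)
Definition rkhs_dual v : H -> R^o := rkhs_dot H v.

Lemma rkhs_dual_is_linear v : linear (rkhs_dual v).
Proof. by move=> a x y; rewrite /rkhs_dual linearDr /= linearZr_LR. Qed.

HB.instance Definition _ v :=
  @GRing.isLinear.Build R H R^o _ (rkhs_dual v) (rkhs_dual_is_linear v).

End rkhs_geometry.

(** * Jordan parts and variation of a difference of two measures *)

Section jordan.
Context (d : measure_display) (X : measurableType d) (R : realType).
Variables (mu : {charge set X -> \bar R}) (m1 m2 : {measure set X -> \bar R}).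
Hypothesis muE : forall A, measurable A -> mu A = (m1 A - m2 A)%E.

Lemma jordan_posI P N (h : hahn_decomposition mu P N) A : measurable A ->
  jordan_pos h A = mu (A `&` P).
Proof. by move=> mA; rewrite jordan_posE cjordan_posE /crestr0 mem_set. Qed.

Lemma jordan_negI P N (h : hahn_decomposition mu P N) A : measurable A ->
  jordan_neg h A = (- mu (A `&` N))%E.
Proof. by move=> mA; rewrite jordan_negE cjordan_negE /crestr0 mem_set. Qed.

Lemma measure_hahn (m : {measure set X -> \bar R}) P N A :
  hahn_decomposition mu P N -> measurable A ->
  m A = (m (A `&` P) + m (A `&` N))%E.
Proof.
move=> [[mP _] [mN _] PN PN0] mA.
rewrite -measureU; [| exact: measurableI | exact: measurableI |].
  by rewrite -setIUr PN setIT.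
by rewrite setIACA PN0 setI0.
Qed.

(** The Hahn pair may differ from [S] and its complement, but only by null sets: on the part of [N]
    inside [S] the charge equals [m1] and is nonpositive, so [m1 N = 0]; likewise [m2 P = 0]. *)
Lemma jordan_singular P N (h : hahn_decomposition mu P N) (S : set X) :
  measurable S -> m1 (~` S) = 0%E -> m2 S = 0%E ->
  forall A, measurable A -> jordan_pos h A = m1 A /\ jordan_neg h A = m2 A.
Proof.
move=> mS m1S m2S A mA; have [[mP P0] [mN N0] _ _] := h.
have null (m : {measure set X -> \bar R}) B C : measurable B -> measurable C ->
    B `<=` C -> m C = 0%E -> m B = 0%E.
  by move=> mB mC BC mC0; apply/eqP; rewrite eq_le measure_ge0 andbT -mC0 le_measure ?inE.
have mI := @measurableI _ X; have mC := @measurableC _ X.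
have splitS (m : {measure set X -> \bar R}) B : measurable B ->
    m B = (m (B `&` S) + m (B `&` ~` S))%E.
  by move=> mB; rewrite (measureDI m mB mS) addeC setDE.
have m1N : m1 N = 0%E.
  have m1SN : m1 (N `&` S) = 0%E.
    have := N0 _ (mI _ _ mN mS) (@subIsetl _ _ _).
    rewrite muE; last exact: mI.
    rewrite [m2 _](null _ _ S) ?sube0 //; last by apply: mI.
    by move=> le0; apply/eqP; rewrite eq_le le0 measure_ge0.
  rewrite (splitS m1 N mN) m1SN add0e.
  by apply: null m1S => //; [apply: mI=> //; exact: mC|exact: mC].
have m2P : m2 P = 0%E.
  have m2SP : m2 (P `&` ~` S) = 0%E.
    have mPS : measurable (P `&` ~` S) by apply: mI => //; exact: mC.
    have := P0 _ mPS (@subIsetl _ _ _).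
    rewrite muE // [m1 _](null _ _ (~` S)) ?sub0e //; last exact: mC.
    by rewrite oppe_ge0 => le0; apply/eqP; rewrite eq_le le0 measure_ge0.
  rewrite (splitS m2 P mP) m2SP adde0.
  by apply: null m2S => //; exact: mI.
have mAP : measurable (A `&` P) by exact: mI.
have mAN : measurable (A `&` N) by exact: mI.
rewrite jordan_posI // jordan_negI // !muE // (measure_hahn m1 h mA) (measure_hahn m2 h mA).
have m1AN : m1 (A `&` N) = 0%E by exact: null m1N.
have m2AP : m2 (A `&` P) = 0%E by exact: null m2P.
by rewrite m1AN m2AP sube0 sub0e oppeK adde0 add0e.
Qed.

(** The positive part has mass [mu P <= m1 P], the negative part mass [- mu N <= m2 N]. *)
Lemma charge_variation_le P N (h : hahn_decomposition mu P N) :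
  (charge_variation h setT <= m1 setT + m2 setT)%E.
Proof.
have [[mP _] [mN _] _ _] := h.
rewrite /charge_variation /= jordan_posI // jordan_negI // !setTI.
apply: leeD.
  rewrite muE //; apply: (@le_trans _ _ (m1 P)); last by apply: le_measure; rewrite ?inE.
  by apply: geeDl; rewrite oppe_le0.
apply: (@le_trans _ _ (m2 N)); last by apply: le_measure; rewrite ?inE.
(* Finiteness of [mu N] makes [m1 N] and [m2 N] finite, so the opposite of their difference can be
   expanded in the extended reals. *)
have: mu N \is a fin_num by exact: fin_num_measure.
rewrite muE // fin_numD fin_numN => /andP[f1 f2].
by rewrite fin_num_oppeB // addeC; apply: geeDl; rewrite oppe_le0.
Qed.

End jordan.

(** * Points told apart by measurable sets *)

Section separation.
Context (d : measure_display) (X : measurableType d) (R : realType).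

Definition separated (x y : X) := exists2 S : set X, measurable S & S x /\ ~ S y.

Lemma separated_sym x y : separated x y -> separated y x.
Proof.
by move=> [S mS [Sx Sy]]; exists (~` S); [exact: measurableC|split => //; exact].
Qed.

(** Take [S (i, j)] containing [a i] and missing [b j], then the union over [i] of the intersections
    over [j]: each intersection misses [b j] through its factor [j]. *)
Lemma separated_family n (a b : nat -> X) :
  (forall i j, (i < n)%N -> (j < n)%N -> separated (a i) (b j)) ->
  exists2 S, measurable S & forall i, (i < n)%N -> S (a i) /\ ~ S (b i).
Proof.
move=> sep.
have {}sep (ij : nat * nat) : exists S : set X,
    measurable S /\ ((ij.1 < n)%N -> (ij.2 < n)%N -> S (a ij.1) /\ ~ S (b ij.2)).
  have [/andP[ni nj]|nij] := boolP ((ij.1 < n) && (ij.2 < n))%N.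
    by have [S mS Sab] := sep _ _ ni nj; exists S.
  by exists setT; split => // ni nj; rewrite ni nj in nij.
have [S HS] := choice sep.
exists (\bigcup_(i in `I_n) \bigcap_(j in `I_n) S (i, j)).
  apply: bigcup_measurable => i _; apply: bigcap_measurableType => j _.
  by have [] := HS (i, j).
move=> i ni; split.
  by exists i => // j nj; have [_ []] := HS (i, j).
by move=> [j nj /(_ i ni)]; have [_ /(_ nj ni)[]] := HS (j, i).
Qed.

(* If every point lies in the measurable atom of one of finitely many points,
   a signed measure is the combination of their Dirac masses weighted by the
   masses of the atoms. *)
Lemma separated_points : ~ finite_dim_signed_measures X R ->
  forall n, exists g : nat -> X,
    forall i j, (i < n)%N -> (j < n)%N -> i != j -> separated (g i) (g j).
Proof.
move=> infdim; elim => [|n [g IH]]; first by exists (fun=> point).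
(* A point separated from all earlier ones extends the family; if there is none, the earlier points
   force finite dimension. *)
have [[y Hy]|] := pselect (exists y, forall i, (i < n)%N -> separated (g i) y).
  exists (fun i => if i == n then y else g i) => i j.
  rewrite !ltnS (leq_eqVlt i) (leq_eqVlt j).
  have [->|_] := eqVneq i n; have [->|_] := eqVneq j n => //=.
  - by move=> _ jn _; apply: separated_sym; exact: Hy.
  - by move=> ni _ _; exact: Hy.
  - exact: IH.
move=> covered; exfalso; apply: infdim.
have sep (ij : nat * nat) : exists S : set X,
    measurable S /\ ((ij.1 < n)%N -> (ij.2 < n)%N -> ij.1 != ij.2 ->
      S (g ij.1) /\ ~ S (g ij.2)).
  have [/and3P[ni nj ne]|nij] := boolP [&& ij.1 < n, ij.2 < n & ij.1 != ij.2]%N.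
    by have [S mS Sab] := IH _ _ ni nj ne; exists S.
  by exists setT; split => // ni nj ne; rewrite ni nj ne in nij.
have [S HS] := choice sep.
pose cell i := \bigcap_(j in [set j | (j < n)%N && (i != j)]) S (i, j).
have mcell i : measurable (cell i).
  by apply: bigcap_measurableType => j _; have [] := HS (i, j).
have cell_self i : (i < n)%N -> cell i (g i).
  by move=> ni j /= /andP[nj ij]; have [_ []] := HS (i, j).
have cell_other i j : (i < n)%N -> (j < n)%N -> i != j -> ~ cell i (g j).
  by move=> ni nj ij /(_ j); rewrite /= nj ij => /(_ isT); have [_ []] := HS (i, j).
(* No point extends the family, so each [y] lies in the same measurable sets as some [g i]. *)
have near y : exists2 i, (i < n)%N & forall B, measurable B -> B (g i) <-> B y.
  apply: contrapT => /forall2NP Hy; apply: covered; exists y => i ni.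
  have [//|/existsNP[B /not_implyP[mB nB]]] := Hy i.
  have [Bg|Bg] := pselect (B (g i)).
    by exists B => //; split => // By; apply: nB.
  apply: separated_sym; exists B => //; split => //.
  by apply: contrapT => By; apply: nB.
(* A point common to two cells would bring its twin [g l] into both, but a cell contains no chosen
   point except its own. *)
have triv : trivIset `I_n cell.
  apply/trivIsetP => i j ni nj ij; apply/seteqP; split => // y [ci cj].
  have [l nl Hl] := near y.
  have [li|li] := eqVneq i l.
    by apply: (cell_other j l nj nl); [rewrite -li eq_sym|apply/Hl].
  by apply: (cell_other i l ni nl li); apply/Hl.
exists n, (fun i => charge_of_finite_measure (\d_(g i))) => nu.
exists (fun i : 'I_n => fine (nu (cell i))) => A mA.
(* Empty sets pad the family, since additivity asks for a disjoint sequence indexed by all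
   naturals. *)
pose F i := if i \in `I_n then A `&` cell i else set0.
have mF i : measurable (F i) by rewrite /F; case: ifP => // _; exact: measurableI.
have AE : A = \big[setU/set0]_(i < n) F i.
  apply/seteqP; split => y; rewrite -bigcup_mkord.
    move=> Ay; have [i ni Hi] := near y; exists i => //.
    by rewrite /F mem_set //; split => //; apply/Hi => //; exact: cell_self.
  by move=> [i ni]; rewrite /F mem_set // => -[].
rewrite {1}AE charge_semi_additive //; last 2 first.
- exact: (trivIset_mkcond _ _).1 (@trivIset_setIl _ _ _ _ (fun=> A) triv).
- exact: bigsetU_measurable.
apply: eq_bigr => i _; rewrite /F mem_set //=.
rewrite fineK ?fin_num_measure // /charge_of_finite_measure /= diracE.
(* A cell is an atom: [A] contains all of it or none of it, according to [g i]. *)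
have [Ag|Ag] := boolP (g i \in A).
  rewrite mule1; congr (nu _); apply/setIidPr => y ci.
  have [j nj Hj] := near y; apply/Hj => //.
  have [<-|ij] := eqVneq (nat_of_ord i) j; first by rewrite inE in Ag.
  by exfalso; apply: (cell_other i j (ltn_ord i) nj ij); apply/Hj.
rewrite mule0 (_ : A `&` cell i = set0) ?charge0 //.
apply/seteqP; split => // y [Ay ci]; have [j nj Hj] := near y.
have [ij|ij] := eqVneq (nat_of_ord i) j.
  by move/negP: Ag; apply; rewrite inE ij; apply/Hj.
by apply: (cell_other i j (ltn_ord i) nj ij); apply/Hj.
Qed.

End separation.

(** * Finite sums of point masses and their embeddings *)

Section point_masses.
Context (d : measure_display) (X : measurableType d) (R : realType).

(** The weight [t] is that of each single point, and repeated points count with multiplicity. *)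
Definition point_masses (t : {nonneg R}) n (a : nat -> X) : {measure set X -> \bar R} :=
  mscale t (msum (fun i => \d_(a i)) n).

Lemma point_massesE (t : {nonneg R}) n a A :
  point_masses t n a A = (t%:num * \sum_(i < n) (a i \in A)%:R)%:E.
Proof.
by rewrite /point_masses /mscale /= /mscale /msum EFinM -sumEFin; congr (_ * _)%E.
Qed.

Lemma point_masses_eq0 (t : {nonneg R}) n (a : nat -> X) (A : set X) :
  (forall i, (i < n)%N -> ~ A (a i)) -> point_masses t n a A = 0%E.
Proof.
move=> aA; rewrite point_massesE big1 ?mulr0 // => i _.
by rewrite memNset //; exact: aA.
Qed.

Local Open Scope ereal_scope.

(** For nonnegative integrands the integral is additive in the measure; the positive and negative
    parts of [f] then recombine, both sums being finite. *)
Lemma integral_point_masses (t : {nonneg R}) n (a : nat -> X) (f : X -> R) :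
  measurable_fun setT f ->
  \int[point_masses t n a]_x (f x)%:E =
  (t%:num * \sum_(i < n) f (a i))%:E.
Proof.
move=> mf; have dirac_sum (g : X -> \bar R) : measurable_fun setT g ->
    (forall x, 0 <= g x) ->
    \int[point_masses t n a]_x g x =
    t%:num%:E * \sum_(i < n) g (a i).
  move=> mg g0; rewrite /point_masses ge0_integral_mscale //.
  rewrite ge0_integral_measure_sum //; congr (_ * _); apply: eq_bigr => i _.
  by rewrite integral_dirac // diracT mul1e.
have mfE : measurable_fun setT (fun x => (f x)%:E) by exact/measurable_EFinP.
rewrite integralE !dirac_sum //; [|exact: measurable_funeneg|exact: measurable_funepos].
under eq_bigr do rewrite funeposE -EFin_max.
under [X in _ - _ * X]eq_bigr do rewrite funenegE -EFinN -EFin_max.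
rewrite !sumEFin -!EFinM -EFinB -mulrBr -sumrB; congr (_ * _)%:E.
apply: eq_bigr => i _.
by case: (leP (f (a i)) 0%R); case: (leP (- f (a i))%R 0%R); lra.
Qed.

Local Close Scope ereal_scope.

(** This is the mixture of [P] and an average of Dirac masses; [n.+1] points rule out an empty
    average. *)
Lemma contaminated_probability (P : probability X R) (t : R) n (a : nat -> X) :
  0 <= t <= 1 -> exists Q : probability X R, forall A, measurable A ->
    Q A = ((1 - t) * fine (P A) + t / n.+1%:R * \sum_(i < n.+1) (a i \in A)%:R)%:E.
Proof.
move=> /andP[t0 t1].
have t1' : 0 <= 1 - t by rewrite subr_ge0.
have tn : 0 <= t / n.+1%:R by apply: divr_ge0.
pose m : {measure set X -> \bar R} :=
  measure_add (mscale (NngNum t1') P) (point_masses (NngNum tn) n.+1 a).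
have mE A : measurable A ->
    m A = ((1 - t) * fine (P A) + t / n.+1%:R * \sum_(i < n.+1) (a i \in A)%:R)%:E.
  move=> mA; have -> : m A = ((1 - t)%:E * P A + point_masses (NngNum tn) n.+1 a A)%E.
    exact: measure_addE.
  by rewrite point_massesE -[in LHS](@fineK _ (P A)) ?fin_num_measure // -EFinM -EFinD.
have m1 : m setT = 1%E.
  rewrite mE // probability_setT mulr1 (eq_bigr (fun=> 1)) => [|i _].
    by rewrite sumr_const card_ord divfK ?subrK // pnatr_eq0.
  by rewrite in_setT.
pose mP := Measure_isProbability.Build _ _ _ (Measure.sort m) m1.
pose Q : probability X R := HB.pack (Measure.sort m) mP.
by exists Q => A mA; rewrite -mE.
Qed.

(* If the embedding v is a genuine Pettis integral, testing it against v itself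
   gives |v|^2 = <v, w> with w the expected finite combination of features, so
   |v| <= |w|; otherwise v is the default value 0. *)
Lemma rkhs_norm_point_masses (k : X -> X -> R) (H : rkhs k)
    (mu : {charge set X -> \bar R}) (c : {nonneg R}) n (a b : nat -> X) (S : set X) :
  measurable S -> (forall i, (i < n)%N -> S (a i) /\ ~ S (b i)) ->
  (forall A, measurable A ->
    mu A = (point_masses c n a A - point_masses c n b A)%E) ->
  rkhs_norm H mu <=
    c%:num * `|\sum_(i < n) (rkhs_feature H (a i) - rkhs_feature H (b i))|.
Proof.
move=> mS Sab muE; rewrite /rkhs_norm /kernel_embedding /pettis_integral.
have [ex|nex] := pselect (exists v, is_pettis_integral mu (rkhs_feature H) v); last first.
  by rewrite xgetPN ?normr0 ?mulr_ge0 // => v Hv; apply: nex; exists v.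
have := xgetPex 0 ex; set v := xget _ _ => Hv.
have [intf vE] := Hv (rkhs_dual v) (@rkhs_dot_continuous _ _ _ H v).
set f := _ \o _ in intf vE.
(* Measurability is part of the integrability required by [is_pettis_integral]. *)
have mf : measurable_fun setT f.
  by apply/measurable_EFinP; have /integrableP[] := intf.
have aS : point_masses c n a (~` S) = 0%E.
  by apply: point_masses_eq0 => i /Sab[Sai _]; apply.
have bS : point_masses c n b S = 0%E by apply: point_masses_eq0 => i /Sab[].
have J := jordan_singular muE (hahnP mu) mS aS bS.
pose w := \sum_(i < n) (rkhs_feature H (a i) - rkhs_feature H (b i)).
have vw : `|v| ^+ 2 = rkhs_dot H v (c%:num *: w).
  rewrite rkhs_normE linearZ /= linear_sum /=.
  move: vE; rewrite /= /rkhs_dual => ->; rewrite /charge_integral /Rintegral.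
  rewrite (eq_measure_integral (point_masses c n a)); last by move=> A mA _; have [] := J A mA.
  rewrite (@eq_measure_integral _ _ _ _ (point_masses c n b) (jordan_neg (hahnP mu))); last first.
    by move=> A mA _; have [] := J A mA.
  rewrite !integral_point_masses //= -mulrBr -sumrB; congr (_ * _).
  by apply: eq_bigr => i _; rewrite linearB.
have : `|v| ^+ 2 <= (c%:num * `|w|) ^+ 2.
  have -> : c%:num * `|w| = `|c%:num *: w| by rewrite normrZ ger0_norm.
  (* As [v] has inner product [|v|^2] with [c w], expanding this square leaves
     [|c w|^2 - |v|^2 >= 0]. *)
  have := sqr_ge0 `|v - c%:num *: w|; rewrite rkhs_normB -vw; lra.
by rewrite ler_pXn2r // nnegrE ?mulr_ge0.
Qed.

End point_masses.

(** * Choice of the point masses and assembly of the two probabilities *)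

Lemma close_point_masses (d : measure_display) (X : measurableType d) (R : realType)
    (k : X -> X -> R) (H : rkhs k) (M : R) n :
  (forall x y, `|k x y| <= M) -> ~ finite_dim_signed_measures X R ->
  exists a b : nat -> X,
    (forall i j, (i < n)%N -> (j < n)%N -> separated (a i) (b j)) /\
    `|\sum_(i < n) (rkhs_feature H (a i) - rkhs_feature H (b i))| ^+ 2
      <= n%:R * (4 * M).
Proof.
move=> kM /separated_points => /(_ n.*2)[g gP].
pose w j := rkhs_feature H (g j.*2) - rkhs_feature H (g j.*2.+1).
have [s Hs] := rkhs_sign_balancing n w.
have bd j (e : bool) : (j < n)%N -> (j.*2 + e < n.*2)%N.
  by rewrite -!mul2n; case: e; lia.
(* The bit [s j] picks the point of pair [j] given to [a]: [false] picks the even index, hence the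
   sign [+]. *)
exists (fun j => g (j.*2 + s j)%N), (fun j => g (j.*2 + ~~ s j)%N); split.
  move=> i j ni nj; apply: gP; [exact: bd|exact: bd|].
  (* The indices differ in their halves if [i] and [j] differ, in their last bit otherwise. *)
  rewrite -!mul2n; apply/eqP; have [->|ij] := eqVneq i j.
    by case: (s j) => /=; lia.
  by case: (s i); case: (s j) => /=; lia.
have sumE : \sum_(i < n) (rkhs_feature H (g (i.*2 + s i)%N)
    - rkhs_feature H (g (i.*2 + ~~ s i)%N)) = \sum_(j < n) (-1) ^+ s j *: w j.
  apply: eq_bigr => j _; rewrite /w.
  by case: (s j); rewrite /= ?addn0 ?addn1 ?expr1 ?expr0 ?scale1r // scaleN1r opprB.
rewrite sumE; apply: le_trans Hs _.
rewrite mulr_natl -[in leRHS](card_ord n) -sumr_const.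
by apply: ler_sum => j _; exact: rkhs_feature_normB.
Qed.

Lemma charge_sub_probE (d : measure_display) (X : measurableType d) (R : realType)
    (P Q : probability X R) A :
  charge_sub (prob_charge P) (prob_charge Q) A = (P A - Q A)%E.
Proof. by []. Qed.

Unset Implicit Arguments.
Set Strict Implicit.

Theorem corollary3p8 (R : realType) (d : measure_display)
    (X : measurableType d) (k : X -> X -> R) (H : rkhs k) :
  ~ finite_dim_signed_measures X R ->
  characteristic H ->
  forall (P : probability X R) (delta eps : R),
    0 < delta -> delta <= 2 -> 0 < eps -> eps < delta ->
    exists Q1 Q2 : probability X R,
      [/\ (tv_norm (charge_sub (prob_charge P) (prob_charge Q1)) <= delta%:E)%E,
          (tv_norm (charge_sub (prob_charge P) (prob_charge Q2)) <= delta%:E)%E,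
          tv_norm (charge_sub (prob_charge Q1) (prob_charge Q2)) = delta%:E &
          rkhs_norm H (charge_sub (prob_charge Q1) (prob_charge Q2)) <= eps].
Proof.
move=> infdim [[_ _ [M kM]] _] P delta eps delta0 delta2 eps0 _.
have M0 : 0 <= M by exact: le_trans (normr_ge0 _) (kM point point).
(* With [N = n.+1] atoms of weight [delta / (2 N)], the squared RKHS norm is at most [(delta / (2
   N))^2 * 4 M N = delta^2 M / N], to be kept below [eps^2]. *)
pose n := Num.bound (delta ^+ 2 * M / eps ^+ 2).
have nP : delta ^+ 2 * M <= eps ^+ 2 * n.+1%:R.
  rewrite -ler_pdivrMl ?exprn_gt0 // [leLHS]mulrC.
  apply: le_trans (ltW (archi_boundP _)) _; last by rewrite ler_nat.
  by rewrite divr_ge0 ?mulr_ge0 ?exprn_ge0 // ltW.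
have [a [b [/separated_family[S mS Sab] ab]]] := close_point_masses H n.+1 kM infdim.
pose t := delta / 2.
have t0 : 0 <= t by rewrite divr_ge0 // ltW.
have t01 : 0 <= t <= 1 by rewrite t0 /t; lra.
have c0 : 0 <= t / n.+1%:R by rewrite divr_ge0.
pose c := NngNum c0.
have [Q1 Q1E] := contaminated_probability P n a t01.
have [Q2 Q2E] := contaminated_probability P n b t01.
have massT (x : nat -> X) : point_masses c n.+1 x setT = t%:E.
  rewrite point_massesE (eq_bigr (fun=> 1)) => [|i _]; last by rewrite in_setT.
  by rewrite sumr_const card_ord /= divfK // pnatr_eq0.
have close (Q : probability X R) (x : nat -> X) : (forall A, measurable A ->
      Q A = ((1 - t) * fine (P A) + t / n.+1%:R * \sum_(i < n.+1) (x i \in A)%:R)%:E) ->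
    (tv_norm (charge_sub (prob_charge P) (prob_charge Q)) <= delta%:E)%E.
  (* [P - Q] is [t P] minus point masses of total mass [t], so its variation is at most
     [2 t = delta]. *)
  move=> QE; pose tP : {measure set X -> \bar R} := mscale (NngNum t0) P.
  have tPE A : measurable A -> tP A = (t * fine (P A))%:E.
    by move=> mA; rewrite EFinM fineK ?fin_num_measure.
  have -> : delta%:E = (tP setT + point_masses c n.+1 x setT)%E.
    by rewrite massT tPE // probability_setT /= mulr1 -EFinD /t; congr EFin; lra.
  apply: charge_variation_le => A mA.
  rewrite charge_sub_probE QE // tPE // point_massesE.
  by rewrite -[in LHS](@fineK _ (P A)) ?fin_num_measure // -!EFinB; congr EFin => /=; ring.
have diffE A : measurable A -> charge_sub (prob_charge Q1) (prob_charge Q2) A =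
    (point_masses c n.+1 a A - point_masses c n.+1 b A)%E.
  move=> mA; rewrite charge_sub_probE.
  by rewrite Q1E // Q2E // !point_massesE -!EFinB; congr EFin; rewrite /=; ring.
exists Q1, Q2; split; [exact: close Q1E|exact: close Q2E| |].
  (* Here [S] makes the two point masses singular, so the variation is exactly [t + t]. *)
  rewrite /tv_norm /charge_variation /=.
  have aS : point_masses c n.+1 a (~` S) = 0%E.
    by apply: point_masses_eq0 => i /Sab[Sai _]; apply.
  have bS : point_masses c n.+1 b S = 0%E by apply: point_masses_eq0 => i /Sab[].
  have [-> ->] := jordan_singular diffE (hahnP _) mS aS bS measurableT.
  by rewrite !massT -EFinD /t; congr EFin; lra.
apply: le_trans (rkhs_norm_point_masses H mS Sab diffE) _.
set s := `|_| in ab *.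
have s0 : 0 <= s by exact: normr_ge0.
have eps_ge0 := ltW eps0; have delta_ge0 := ltW delta0.
(* After clearing [N = n.+1], compare squares: [t^2 s^2 <= delta^2 M N <= eps^2 N^2]. *)
rewrite /= mulrAC ler_pdivrMr // -(@ler_pXn2r _ 2) ?nnegrE ?mulr_ge0 //.
rewrite (exprMn 2 t) (exprMn 2 eps); apply: (le_trans (ler_wpM2l (sqr_ge0 t) ab)).
have -> : t ^+ 2 * (n.+1%:R * (4 * M)) = delta ^+ 2 * M * n.+1%:R by rewrite /t; field.
by rewrite (expr2 n.+1%:R) mulrA ler_wpM2r.
Qed.
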